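(* Let $G$ be a $\Delta$-regular Ramanujan graph on $n$ vertices and let $C$ be an $[n,r_0n,\delta_0n]$ code over $\mathbb F_q$. Then the expander code $\mathcal C_{\mathrm{exp}}=\phi_{\mathrm{exp}}(C)$ over $\mathbb F_{q^\Delta}$ has minimum distance at least $$\frac{\Delta\,\delta_0\,n}{\delta_0\Delta+4(1-\delta_0)}.$$
   Context: Graphs are finite, simple and undirected, with $n\ge 2$ vertices and $\Delta\ge1$. For a graph $G$ on $n$ vertices with adjacency matrix $A$ and eigenvalues $\lambda_0\ge\lambda_1\ge\cdots\ge\lambda_{n-1}$ of $A$ (with multiplicity), $\mu(G)=\max\{\lambda_1,|\lambda_{n-1}|\}$. A $\Delta$-regular graph $G$ is called Ramanujan if $\mu(G)\le 2\sqrt{\Delta-1}$. An $[n,k,D]$ code over $\mathbb F_q$ is a $k$-dimensional $\mathbb F_q$-linear subspace of $\mathbb F_q^n$ with minimum Hamming distance $D$. Expander code: label the vertices of $G$ by $1,\dots,n$. For each vertex $i$ let $l_1(i),\dots,l_\Delta(i)$ be the $\Delta$ vertices adjacent to $i$, in some prespecified order. Identify $\mathbb F_{q^\Delta}$ with $\mathbb F_q^\Delta$ (as $\mathbb F_q$-vector spaces). The map $\phi_{\mathrm{exp}}:\mathbb F_q^n\to\mathbb F_{q^\Delta}^n$ sends $[a_1,\dots,a_n]$ to $[\alpha_1,\dots,\alpha_n]$ with $\alpha_i=[a_{l_1(i)},a_{l_2(i)},\dots,a_{l_\Delta(i)}]$. The expander code is $\mathcal C_{\mathrm{exp}}=\phi_{\mathrm{exp}}(C)$;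 it need not be $\mathbb F_{q^\Delta}$-linear. Its minimum distance is the minimum Hamming distance (number of coordinates in $\mathbb F_{q^\Delta}$ that differ) between distinct codewords. *)

(* Defs.v *)
From HB Require Import structures.
From mathcomp Require Import all_boot all_order all_algebra all_field.
From mathcomp Require Import polyrcf.

Set Implicit Arguments.
Unset Strict Implicit.
Unset Printing Implicit Defensive.

Import Order.TTheory GRing.Theory Num.Theory.
Local Open Scope ring_scope.

(* A graph on the vertices 0, ..., n-1 is given by its adjacency relation,    *)
(* assumed symmetric and irreflexive wherever it is used.                     *)

Definition regular (n : nat) (e : rel 'I_n) (Delta : nat) : Prop :=
  forall i, #|[set j | e i j]| = Delta.

Definition adjacency_mx (R : nzRingType) (n : nat) (e : rel 'I_n) : 'M[R]_n :=
  \matrix_(i, j) (e i j)%:R.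

(* The roots in R of the characteristic polynomial, repeated according to     *)
(* multiplicity, in nonincreasing order. [rootsR] lists each root once. When  *)
(* A is symmetric all roots of its characteristic polynomial lie in R, so     *)
(* this sequence has length n.                                                *)
Definition eigenvalues (R : rcfType) (n : nat) (A : 'M[R]_n) : seq R :=
  sort >=%R
    (flatten [seq nseq (mup x (char_poly A)) x | x <- rootsR (char_poly A)]).

Definition mu (R : rcfType) (n : nat) (e : rel 'I_n) : R :=
  let lambda := eigenvalues (adjacency_mx R e) in
  Num.max lambda`_1 `|lambda`_n.-1|.

Definition ramanujan (R : rcfType) (n : nat) (e : rel 'I_n) (Delta : nat) :
    Prop :=
  regular e Delta /\ mu R e <= 2 * Num.sqrt (Delta%:R - 1).

Definition hamming (A : eqType) (n : nat) (x y : 'rV[A]_n) : nat :=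
  #|[set i | x 0 i != y 0 i]|.

(* No [d] satisfies this when [C] has fewer than two codewords.               *)
Definition is_min_distance (A : eqType) (n : nat) (C : {pred 'rV[A]_n})
    (d : nat) : Prop :=
  (exists x y, [/\ x \in C, y \in C, x != y & hamming x y = d]) /\
  (forall x y, x \in C -> y \in C -> x != y -> (d <= hamming x y)%N).

Definition is_code (F : finFieldType) (n k D : nat) (C : {vspace 'rV[F]_n}) :
    Prop :=
  \dim C = k /\ is_min_distance C D.

Definition neighbor_listing (n Delta : nat) (e : rel 'I_n)
    (l : 'I_n -> Delta.-tuple 'I_n) : Prop :=
  forall i, perm_eq (l i) (enum [set j | e i j]).

(* [iota] is the identification of F_q^Delta with its degree-Delta extension. *)
Definition phi_exp (F : finFieldType) (n Delta : nat) (L : fieldExtType F)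
    (iota : 'rV[F]_Delta -> L) (l : 'I_n -> Delta.-tuple 'I_n)
    (a : 'rV[F]_n) : 'rV[L]_n :=
  \row_i iota (\row_j a 0 (tnth (l i) j)).

Definition expander_code (F : finFieldType) (n Delta : nat)
    (L : fieldExtType F) (iota : 'rV[F]_Delta -> L)
    (l : 'I_n -> Delta.-tuple 'I_n) (C : {vspace 'rV[F]_n}) :
    {pred 'rV[L]_n} :=
  [pred w | [exists a : 'rV[F]_n, (a \in C) && (w == phi_exp iota l a)]].

(* Main.v *)
(* Let S be the support of the difference of two codewords of C. Their images *)
(* under phi_exp differ exactly on the set T of vertices with a neighbour in  *)
(* S, so the theorem is Tanner's bound on |T|. For the adjacency matrix A of  *)
(* a Delta-regular graph with indicator vector v of S, the vector A v is      *)
(* supported in T and sums to Delta |S|, whence                               *)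
(*   (Delta |S|)^2 <= |T| |A v|^2                                             *)
(* by Cauchy-Schwarz. Splitting v along the all-one vector gives              *)
(*   |A v|^2 <= (Delta |S|)^2 / n + mu^2 |S| (1 - |S| / n),                   *)
(* because A has norm at most mu on the orthogonal complement of that vector. *)
(* Finally mu^2 <= 4 Delta, and the resulting bound increases with |S|.       *)
Require Import Defs.
From HB Require Import structures.
From mathcomp Require Import all_boot all_order all_algebra all_field.
From mathcomp Require Import polyrcf complex ring lra.

Set Implicit Arguments.
Unset Strict Implicit.
Unset Printing Implicit Defensive.

Import Order.TTheory GRing.Theory Num.Theory.
Local Open Scope ring_scope.
Local Open Scope sesquilinear_scope.
Local Open Scope complex_scope.

(** The norm bound behind Tanner's inequality is the delicate point, since [mu] is read off a sorted
    list of characteristic roots. [symmetric_spectral] identifies that list with the diagonal of A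
    in an orthonormal eigenbasis. [orthogonal_top_eigenvector_bound] then bounds A on the complement
    of the all-one vector without assuming the graph connected: if Delta is a repeated eigenvalue,
    then [mu] is already Delta; otherwise the all-one vector spans the eigenline of Delta.

    [tanner_bound] and [ramanujan_expansion] turn this into vertex expansion, with D in place of
    |S|, and [hamming_phi_exp] turns expansion into distance. The same inequality shows that
    [phi_exp] is injective on C, so the image has a minimum distance. *)

(** * Spectrum of a real symmetric matrix *)

Lemma char_poly_similar (F : fieldType) n (P A : 'M[F]_n) :
  P \in unitmx -> char_poly (invmx P *m A *m P) = char_poly A.
Proof.
move=> Pu; rewrite /char_poly.
have -> : char_poly_mx (invmx P *m A *m P) =
    map_mx polyC (invmx P) *m char_poly_mx A *m map_mx polyC P.
  rewrite /char_poly_mx mulmxBr mulmxBl -!map_mxM; congr (_ - _).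
  by rewrite mul_mx_scalar -scalemxAl -map_mxM mulVmx // map_mx1 scalemx1.
by rewrite !det_mulmx mulrC mulrA -det_mulmx -map_mxM mulmxV // map_mx1 det1
  mul1r.
Qed.

Lemma mup_prod_XsubC (F : fieldType) (x : F) (s : seq F) :
  mup x (\prod_(y <- s) ('X - y%:P)) = count_mem x s.
Proof.
elim: s => [|y s IHs]; first by rewrite big_nil mupNroot // root1.
rewrite big_cons mupM ?polyXsubC_eq0 ?monic_neq0 ?monic_prod_XsubC // IHs.
by rewrite -['X - _]expr1 mup_XsubCX /=; case: eqP.
Qed.

(** Each x occurs in either list as often as its multiplicity as a root; in [eigenvalues] only the
    block of x contributes to that count. *)
Lemma perm_eigenvalues (R : rcfType) n (A : 'M[R]_n) (s : seq R) :
  char_poly A = \prod_(y <- s) ('X - y%:P) -> perm_eq (eigenvalues A) s.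
Proof.
move=> Achi; rewrite /eigenvalues perm_sort; apply/allP => x _ /=; apply/eqP.
have Achi_neq0 : char_poly A != 0 by rewrite monic_neq0 ?char_poly_monic.
rewrite -[RHS]mup_prod_XsubC -Achi count_flatten -map_comp sumnE big_map.
under eq_bigr do rewrite /= count_nseq.
have root_mem : x \in rootsR (char_poly A) = root (char_poly A) x.
  by rewrite -(roots_on_rootsR Achi_neq0) in_itv.
have [xr|xr] := boolP (root (char_poly A) x); last first.
  rewrite mupNroot // big_seq big1 // => y.
  case: (y =P x) => [->|]; last by rewrite /= => /eqP/negPf->.
  by rewrite root_mem (negPf xr).
rewrite (bigD1_seq x) ?root_mem ?uniq_roots //= eqxx mul1n big1 ?addn0 // => y.
by move=> /negPf ->.
Qed.

(** Over R[i] the matrix is Hermitian, so it is unitarily diagonalisable with real diagonal, which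
    descends to a vector r over R. *)
Lemma symmetric_spectral (R : rcfType) n (A : 'M[R]_n) : A^T = A ->
  exists2 P : 'M[R[i]]_n, P \is unitarymx & exists2 r : 'rV[R]_n,
    map_mx (real_complex R) A
      = P ^t* *m diag_mx (map_mx (real_complex R) r) *m P &
    perm_eq (eigenvalues A) [seq r 0 i | i : 'I_n].
Proof.
move=> symA; set toC := real_complex R; pose B := map_mx toC A.
have symB : B \is symmetricmx.
  apply/is_hermitianmxP; rewrite expr0 scale1r /B -{1}symA.
  by apply/matrixP=> i j; rewrite !mxE.
have realB : B \is a mxOver Num.real.
  by apply/mxOverP=> i j; rewrite mxE complex_real.
have defB := orthomx_spectralP (symmetric_normalmx symB realB).
have /mxOverP real_sp :=
  hermitian_spectral_diag_real (realsym_hermsym symB realB).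
set P := spectralmx B in defB; set d := spectral_diag B in defB real_sp.
have Pu : P \is unitarymx := spectral_unitarymx B.
pose r : 'rV[R]_n := map_mx (@complex.Re R) d.
have defd : d = map_mx toC r.
  by apply/rowP=> i; rewrite !mxE; apply/esym/RRe_real.
exists P => //; exists r; first by rewrite -defd -invmx_unitary.
(* The factorisation over R may be checked in R[i], where A is similar to a diagonal matrix. *)
apply: perm_eigenvalues; apply: (map_poly_inj toC).
rewrite map_char_poly -/B defB char_poly_similar ?unitarymx_unit //.
rewrite char_poly_trig ?diag_mx_is_trig // big_image /= rmorph_prod.
apply: eq_bigr => i _.
by rewrite rmorphB /= map_polyX map_polyC /= defd !mxE eqxx.
Qed.

Lemma mem_eigenvalues (R : rcfType) n (A : 'M[R]_n) (x : R) :
  x \in eigenvalues A -> eigenvalue A x.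
Proof.
have Achi_neq0 : char_poly A != 0 by rewrite monic_neq0 ?char_poly_monic.
rewrite mem_sort => /flattenP[_ /mapP[y + ->]].
rewrite -(roots_on_rootsR Achi_neq0) -eigenvalue_root_char in_itv /= => yA.
by rewrite mem_nseq => /andP[_ /eqP->].
Qed.

(** * Norm bound orthogonally to the top eigenvector *)

(** The largest value d heads the sorted list, so all other entries lie between its last entry and
    its entry of index 1. *)
Lemma eigenvalues_tail_le (R : rcfType) n (A : 'M[R]_n) (s : seq R) (m d : R) :
    perm_eq (eigenvalues A) (d :: s) -> size s = n.-1 -> (1 < n)%N ->
    {in s, forall x, x <= d} ->
    m = Num.max (eigenvalues A)`_1 `|(eigenvalues A)`_n.-1| ->
  {in s, forall x, `|x| <= m}.
Proof.
move=> permA size_s n_gt1 s_le_d ->.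
set lam := eigenvalues A in permA *.
have sorted_lam : sorted >=%R lam.
  by apply: sort_sorted => x y; rewrite orbC le_total.
have trans_ge : transitive (>=%R : rel R) by move=> y x z /= ? /le_trans; exact.
have size_lam : size lam = n.
  by rewrite (perm_size permA) /= size_s; case: (n) n_gt1.
case: (lam) sorted_lam size_lam permA => [|a t] /= sorted_lam size_lam permA.
  by rewrite -size_lam in n_gt1.
have a_max x : x \in t -> x <= a.
  by move: sorted_lam; rewrite path_sortedE // => /andP[/allP + _]; apply.
have ad : a = d.
  apply/le_anti/andP; split.
    have: a \in d :: s by rewrite -(perm_mem permA) mem_head.
    by rewrite inE => /predU1P[->//|]; apply: s_le_d.
  have: d \in a :: t by rewrite (perm_mem permA) mem_head.
  by rewrite inE => /predU1P[->//|]; apply: a_max.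
move: permA; rewrite ad perm_cons => permA x.
rewrite -(perm_mem permA) => /(nthP 0)[k lt_k <-].
have sorted_t : sorted >=%R t by apply: path_sorted sorted_lam.
(* As t is nonempty, index n.-1 of the whole list is the last index of t. *)
have n1 : n.-1 = (size t).-1.+1 by rewrite -size_lam /=; case: (t) lt_k.
have ge_t i j : (i <= j)%N -> (j < size t)%N -> t`_j <= t`_i.
  move=> le_ij lt_j.
  apply: (sorted_leq_nth trans_ge (@lexx _ R) 0 sorted_t) => //.
  exact: leq_ltn_trans lt_j.
rewrite n1 /= ler_norml lerNl !le_max ge_t //= andbT; apply/orP; right.
rewrite lerNl; apply: le_trans (lerNnormlW (lexx _)) (ge_t _ _ _ _).
  by rewrite -ltnS -n1 -size_lam.
by rewrite ltn_predL (leq_trans _ lt_k).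
Qed.

(** In an orthonormal eigenbasis A scales coordinate i by [r 0 i], so it suffices that [r 0 i] is at
    most m in absolute value wherever x has a nonzero coordinate. The only possible exception is the
    coordinate along u, which vanishes for x. *)
Lemma orthogonal_top_eigenvector_bound (R : rcfType) n (A : 'M[R]_n)
    (u x : 'rV[R]_n) (d m : R) :
    (1 < n)%N -> A^T = A -> u != 0 -> u *m A = d *: u ->
    (forall a, eigenvalue A a -> `|a| <= d) ->
    m = Num.max (eigenvalues A)`_1 `|(eigenvalues A)`_n.-1| ->
    \sum_i x 0 i * u 0 i = 0 ->
  \sum_i (x *m A) 0 i ^+ 2 <= m ^+ 2 * \sum_i x 0 i ^+ 2.
Proof.
move=> n_gt1 symA u_neq0 uA spA def_m xu0.
have m_ge0 : 0 <= m by rewrite def_m le_max normr_ge0 orbT.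
have [P Pu [r defA perm_r]] := symmetric_spectral symA.
set toC := real_complex R in defA.
(* Y z lists the coordinates of z in an orthonormal eigenbasis of A. *)
pose Y (z : 'rV[R]_n) := map_mx toC z *m P ^t*.
have YP z : map_mx toC z = Y z *m P by rewrite /Y mulmxKtV.
have YA z i : Y (z *m A) 0 i = toC (r 0 i) * Y z 0 i.
  rewrite {1}/Y map_mxM defA !mulmxA mulmxtVK // mul_mx_diag !mxE mulrC.
  by congr (_ * _).
have parseval (z w : 'rV[R]_n) :
    toC (\sum_i z 0 i * w 0 i) = \sum_i Y z 0 i * (Y w 0 i)^*.
  have: (map_mx toC z *m (map_mx toC w) ^t*) 0 0 = (Y z *m (Y w) ^t*) 0 0.
    by rewrite {1}YP {1}(YP w) trmx_mul map_mxM !mulmxA mulmxtVK.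
  rewrite !mxE /toC rmorph_sum => H.
  transitivity (\sum_j map_mx toC z 0 j * ((map_mx toC w) ^t*) j 0).
    apply: eq_bigr => i _.
    by rewrite !mxE rmorphM /= conj_Creal // complex_real.
  by rewrite H; apply: eq_bigr => i _; rewrite !mxE.
have rE i : eigenvalue A (r 0 i).
  by apply: mem_eigenvalues; rewrite (perm_mem perm_r) image_f.
have r_le i : r 0 i <= d by apply: le_trans (ler_norm _) (spA _ (rE i)).
suff bound i : Y x 0 i = 0 \/ `|r 0 i| <= m.
  rewrite -lecR rmorphM -/toC.
  under eq_bigr do rewrite expr2.
  under [X in _ * _ X]eq_bigr do rewrite expr2.
  rewrite -[X in _ <= X]/(toC _ * toC _) !parseval mulr_sumr.
  apply: ler_sum => i _.
  rewrite YA -!normCK normrM exprMn.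
  have [->|le_m] := bound i; first by rewrite normr0 expr0n !mulr0.
  rewrite ler_wpM2r ?exprn_ge0 // -normrX -rmorphXn.
  rewrite ger0_norm ?lecR ?ler0c ?sqr_ge0 //.
  by rewrite -real_normK ?num_real // lerXn2r ?nnegrE.
(* When m < d, the eigenvalue d is simple, so u spans its eigenline. *)
have [d_le_m|m_lt_d] := leP d m.
  by right; apply: le_trans (spA _ (rE i)) d_le_m.
have [i0 Yi0] : exists i0, Y u 0 i0 != 0.
  apply/existsP; apply: contraNT u_neq0; rewrite negb_exists => /forallP Y0.
  rewrite -(map_mx_eq0 toC) YP (_ : Y u = 0) ?mul0mx //.
  by apply/rowP=> j; rewrite [RHS]mxE; apply/eqP/negbNE/Y0.
have Yu_r j : Y u 0 j != 0 -> r 0 j = d.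
  move=> Yj; have := YA u j; rewrite uA /Y map_mxZ -scalemxAl mxE -/(Y u).
  by move/(mulIf Yj)/complexI.
pose t := [seq r 0 j | j <- rem i0 (enum 'I_n)].
have perm_t : perm_eq (eigenvalues A) (d :: t).
  apply: perm_trans perm_r _; rewrite -{1}(Yu_r i0) //.
  exact: (perm_map _ (perm_to_rem (mem_enum _ i0))).
have size_t : size t = n.-1.
  by rewrite size_map size_rem ?mem_enum // size_enum_ord.
have t_le : {in t, forall a, `|a| <= m}.
  by apply: eigenvalues_tail_le perm_t _ _ _ def_m => // _ /mapP[j _ ->].
have r_small j : j != i0 -> `|r 0 j| <= m.
  move=> ji0; apply/t_le/map_f.
  by rewrite mem_rem_uniq ?enum_uniq // inE ji0 mem_enum.
have [->|] := eqVneq i i0; last by right; apply: r_small.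
(* Only the term i0 survives in the product of x and u: a nonzero coordinate of u at another j would
   force [r 0 j = d], beyond m. *)
left; have := parseval x u.
rewrite xu0 /toC rmorph0 (bigD1 i0) //= big1 => [|j ji0].
  rewrite addr0 => /esym/eqP.
  by rewrite mulf_eq0 conjC_eq0 (negPf Yi0) orbF => /eqP.
have [->|/Yu_r rjd] := eqVneq (Y u 0 j) 0; first by rewrite conjC0 mulr0.
have := le_lt_trans (le_trans (ler_norm _) (r_small j ji0)) m_lt_d.
by rewrite rjd ltxx.
Qed.

(** * Vertex expansion of regular graphs *)

Lemma adjacency_col_sum (R : nzRingType) n (e : rel 'I_n) Delta (j : 'I_n) :
    symmetric e -> regular e Delta ->
  \sum_i adjacency_mx R e i j = Delta%:R.
Proof.
move=> e_sym e_reg; rewrite -(e_reg j) -sum1_card natr_sum [RHS]big_mkcond /=.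
by apply: eq_bigr => i _; rewrite mxE inE e_sym; case: (e j i).
Qed.

(** At an entry of largest absolute value of an eigenvector, a times that entry is a sum of Delta
    entries that are no larger. *)
Lemma regular_eigenvalue_le (R : rcfType) n (e : rel 'I_n) Delta (a : R) :
    symmetric e -> regular e Delta -> eigenvalue (adjacency_mx R e) a ->
  `|a| <= Delta%:R.
Proof.
move=> e_sym e_reg /eigenvalueP[v va v_neq0].
have [i0 vi0] : exists i, v 0 i != 0.
  apply/existsP; apply: contraNT v_neq0; rewrite negb_exists => /forallP v0.
  by apply/eqP/rowP=> i; rewrite [RHS]mxE; apply/eqP/negbNE/v0.
have [j _ j_max] := @arg_maxP _ _ _ i0 xpredT (fun i => `|v 0 i|) isT.
have vj_gt0 : 0 < `|v 0 j|.
  by apply: lt_le_trans (j_max i0 isT); rewrite normr_gt0.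
rewrite -(ler_pM2r vj_gt0) -normrM.
have -> : a * v 0 j = \sum_i v 0 i * adjacency_mx R e i j.
  by move/rowP/(_ j): va; rewrite !mxE.
rewrite -(adjacency_col_sum R j e_sym e_reg) mulr_suml.
apply: le_trans (ler_norm_sum _ _ _) _; apply: ler_sum => i _.
by rewrite normrM mulrC mxE normr_nat ler_wpM2l //; exact: j_max.
Qed.

(** Cauchy-Schwarz against the indicator of T, proved by writing the defect, scaled by |T|, as a sum
    of squares. *)
Lemma sqr_sum_le_card (R : realFieldType) (I : finType) (T : {set I})
    (w : I -> R) :
    (forall i, i \notin T -> w i = 0) ->
  (\sum_i w i) ^+ 2 <= #|T|%:R * \sum_i w i ^+ 2.
Proof.
move=> wT; have [T0|T_gt0] := posnP #|T|.
  rewrite T0 mul0r big1 ?expr0n // => i _; apply: wT.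
  by rewrite (cards0_eq T0) inE.
have restr (f : I -> R) : (forall i, i \notin T -> f i = 0) ->
    \sum_i f i = \sum_(i in T) f i.
  move=> fT; rewrite (bigID (mem T)) /= [X in _ + X]big1 ?addr0 //.
rewrite (restr w wT) (restr (fun i => w i ^+ 2)) => [|i /wT->];
  last by rewrite expr0n.
set s := \sum_(i in T) w i; set W := \sum_(i in T) _; set t := #|T|%:R.
have t_gt0 : 0 < t by rewrite ltr0n.
suff : 0 <= t * (t * W - s ^+ 2) by rewrite pmulr_rge0 // subr_ge0.
have -> : t * (t * W - s ^+ 2) = \sum_(i in T) (t * w i - s) ^+ 2.
  have sqrE i : (t * w i - s) ^+ 2 =
      t ^+ 2 * w i ^+ 2 - (t * s) *+ 2 * w i + s ^+ 2 by ring.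
  under eq_bigr do rewrite sqrE.
  rewrite big_split sumrB sumr_const /= -!mulr_sumr -/W -/s.
  by rewrite -[s ^+ 2 *+ _]mulr_natl -/t; ring.
by apply: sumr_ge0 => i _; apply: sqr_ge0.
Qed.

Lemma tanner_bound (R : rcfType) n (e : rel 'I_n) Delta (S : {set 'I_n}) :
    (1 < n)%N -> symmetric e -> regular e Delta -> S != set0 ->
  Delta%:R ^+ 2 * #|S|%:R * n%:R <=
  #|[set i | [exists j in S, e i j]]|%:R
    * (Delta%:R ^+ 2 * #|S|%:R + mu R e ^+ 2 * (n%:R - #|S|%:R)).
Proof.
move=> n_gt1 e_sym e_reg S_neq0; set T := [set i | _].
pose A := adjacency_mx R e.
have n_gt0 : 0 < n%:R :> R by rewrite ltr0n ltnW.
have s_gt0 : 0 < #|S|%:R :> R by rewrite ltr0n card_gt0.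
have symA : A^T = A by apply/matrixP=> i j; rewrite !mxE e_sym.
have colA j : \sum_i A i j = Delta%:R by apply: adjacency_col_sum.
pose s : R := #|S|%:R; pose t : R := #|T|%:R.
pose v : 'rV[R]_n := \row_i (i \in S)%:R.
have sum_v : \sum_i v 0 i = s.
  rewrite /s -sum1_card natr_sum [RHS]big_mkcond.
  by apply: eq_bigr => i _; rewrite mxE; case: (i \in S).
have sum_v2 : \sum_i v 0 i ^+ 2 = s.
  by rewrite -sum_v; apply: eq_bigr => i _; rewrite mxE -natrX; case: (i \in S).
pose w := v *m A; pose W := \sum_j w 0 j ^+ 2.
have sum_w : \sum_j w 0 j = Delta%:R * s.
  under eq_bigr do rewrite mxE.
  rewrite exchange_big -sum_v mulr_sumr; apply: eq_bigr => i _.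
  rewrite -mulr_sumr mulrC; congr (_ * _); rewrite -(colA i).
  by apply: eq_bigr => j _; rewrite -[in LHS]symA mxE.
(* The entry [w 0 j] counts the neighbours of j in S. *)
have wT j : j \notin T -> w 0 j = 0.
  rewrite inE negb_exists => /forallP NT; rewrite mxE big1 // => i _.
  have := NT i; rewrite !mxE e_sym.
  by case: (i \in S) => /=; [move=> /negPf->; rewrite mulr0 | rewrite mul0r].
have CS : (Delta%:R * s) ^+ 2 <= t * W.
  by rewrite -sum_w; apply: sqr_sum_le_card.
pose u : 'rV[R]_n := const_mx 1.
have uA : u *m A = Delta%:R *: u.
  apply/rowP=> j; rewrite !mxE mulr1 -(colA j).
  by apply: eq_bigr => i _; rewrite !mxE mul1r.
have u_neq0 : u != 0.
  apply/negP => /eqP/rowP/(_ (Ordinal (ltnW n_gt1))); rewrite !mxE => /eqP.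
  by rewrite oner_eq0.
(* This is n times the component of v orthogonal to the all-one vector u; the scaling avoids
   division. *)
pose x := n%:R *: v - s *: u.
have xE i : x 0 i = n%:R * v 0 i - s by rewrite !mxE mulr1.
have sum_const (c : R) : \sum_(i < n) c = n%:R * c.
  by rewrite sumr_const card_ord mulr_natl.
have xu0 : \sum_i x 0 i * u 0 i = 0.
  under eq_bigr do rewrite xE [u 0 _]mxE mulr1.
  by rewrite sumrB sum_const -mulr_sumr sum_v subrr.
have sum_x2 : \sum_i x 0 i ^+ 2 = n%:R * (s * (n%:R - s)).
  have sqrE i : x 0 i ^+ 2 =
      n%:R ^+ 2 * v 0 i ^+ 2 - n%:R * s *+ 2 * v 0 i + s ^+ 2.
    by rewrite xE; ring.
  under eq_bigr do rewrite sqrE.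
  by rewrite big_split sumrB sum_const -!mulr_sumr sum_v sum_v2 /=; ring.
have sum_xA2 : \sum_i (x *m A) 0 i ^+ 2 =
    n%:R * (n%:R * W - (Delta%:R * s) ^+ 2).
  have xAE i : (x *m A) 0 i = n%:R * w 0 i - s * Delta%:R.
    by rewrite mulmxBl -!scalemxAl uA !mxE mulr1.
  have sqrE i : (x *m A) 0 i ^+ 2 = n%:R ^+ 2 * w 0 i ^+ 2
      - n%:R * s * Delta%:R *+ 2 * w 0 i + (s * Delta%:R) ^+ 2.
    by rewrite xAE; ring.
  under eq_bigr do rewrite sqrE.
  by rewrite big_split sumrB sum_const -!mulr_sumr sum_w -/W /=; ring.
have := orthogonal_top_eigenvector_bound n_gt1 symA u_neq0 uA
  (fun a => regular_eigenvalue_le e_sym e_reg) (erefl _) xu0.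
rewrite -/(mu R e) sum_x2 sum_xA2 mulrCA ler_pM2l // => W_le.
(* The statement has one factor |S| cancelled; restoring it makes the left side n times that of
   [CS]. *)
rewrite -(ler_pM2l s_gt0) -/s -/t.
have -> : s * (Delta%:R ^+ 2 * s * n%:R) = n%:R * (Delta%:R * s) ^+ 2 by ring.
apply: le_trans (ler_wpM2l (ltW n_gt0) CS) _.
rewrite mulrCA [leRHS]mulrCA ler_wpM2l ?ler0n //.
rewrite mulrDr -[Delta%:R ^+ 2 * s](mulrC s); move: W_le.
by rewrite lerBlDl; lra.
Qed.

Lemma ramanujan_expansion (R : rcfType) n (e : rel 'I_n) Delta
    (S : {set 'I_n}) D :
    (1 < n)%N -> (0 < Delta)%N -> symmetric e -> ramanujan R e Delta ->
    (0 < D <= #|S|)%N ->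
  (Delta * D * n)%:R <=
    #|[set i | [exists j in S, e i j]]|%:R
      * ((Delta * D)%:R + 4 * (n%:R - D%:R)) :> R.
Proof.
move=> n_gt1 Delta_gt0 e_sym [e_reg mu_le] /andP[D_gt0 D_le].
have S_neq0 : S != set0 by rewrite -card_gt0 (leq_trans D_gt0).
have := tanner_bound R n_gt1 e_sym e_reg S_neq0.
set t : R := #|[set i | _]|%:R; set s : R := #|S|%:R.
have s_gt0 : 0 < s by rewrite ltr0n card_gt0.
have s_le : s <= n%:R by rewrite ler_nat -[leqRHS](card_ord n) max_card.
have D_le_s : D%:R <= s by rewrite ler_nat.
have t_ge0 : 0 <= t by rewrite ler0n.
have del_ge1 : 1 <= Delta%:R :> R by rewrite ler1n.
have del_gt0 : 0 < Delta%:R :> R by rewrite ltr0n.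
(* Weakening 4 (Delta - 1) to 4 Delta lets a factor Delta cancel in Tanner's bound. *)
have mu2_le : mu R e ^+ 2 <= 4 * Delta%:R.
  have mu_ge0 : 0 <= mu R e by rewrite le_max normr_ge0 orbT.
  apply: le_trans (_ : (2 * Num.sqrt (Delta%:R - 1)) ^+ 2 <= _).
    by rewrite lerXn2r ?nnegrE // (le_trans mu_ge0).
  by rewrite exprMn sqr_sqrtr ?subr_ge0 //; lra.
move=> tanner.
have expand_S : Delta%:R * s * n%:R <= t * (Delta%:R * s + 4 * (n%:R - s)).
  rewrite -(ler_pM2l del_gt0).
  have -> : Delta%:R * (t * (Delta%:R * s + 4 * (n%:R - s))) =
      t * (Delta%:R ^+ 2 * s + 4 * Delta%:R * (n%:R - s)) by ring.
  rewrite !mulrA -expr2; apply: le_trans tanner _.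
  by rewrite ler_wpM2l // lerD2l ler_wpM2r ?subr_ge0.
(* Monotonicity in |S| with denominators cleared: after cross-multiplication by s and D, the two
   right-hand sides differ by 4 t n (s - D). *)
rewrite !natrM -(ler_pM2l s_gt0).
apply: le_trans (_ : D%:R * (t * (Delta%:R * s + 4 * (n%:R - s))) <= _).
  rewrite [leLHS](_ : _ = D%:R * (Delta%:R * s * n%:R)); last by ring.
  by rewrite ler_wpM2l ?ler0n.
rewrite -subr_ge0 [leRHS](_ : _ = 4 * t * n%:R * (s - D%:R)); last by ring.
by rewrite !mulr_ge0 ?subr_ge0 ?ler0n.
Qed.

(** * Distance of the expander code *)

(** Coordinate i of the image records exactly the values at the neighbours of i, and [iota] loses
    nothing. *)
Lemma hamming_phi_exp (F : finFieldType) n Delta (e : rel 'I_n)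
    (l : 'I_n -> Delta.-tuple 'I_n) (L : fieldExtType F)
    (iota : 'rV[F]_Delta -> L) (a b : 'rV[F]_n) :
    neighbor_listing e l -> injective iota ->
  hamming (phi_exp iota l a) (phi_exp iota l b) =
    #|[set i | [exists j in [set j | a 0 j != b 0 j], e i j]]|.
Proof.
move=> hl iota_inj; rewrite /hamming; congr #|pred_of_set _|; apply/setP=> i.
have mem_l j : (j \in (l i : seq _)) = e i j.
  by rewrite (perm_mem (hl i)) mem_enum inE.
rewrite !inE !mxE (inj_eq iota_inj); apply/idP/idP => [|/existsP[j]].
  apply: contraNT; rewrite negb_exists => /forallP no_diff.
  apply/eqP/rowP=> k; rewrite !mxE.
  have := no_diff (tnth (l i) k).
  by rewrite inE -mem_l mem_tnth andbT negbK => /eqP.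
rewrite inE -mem_l => /andP[ab_j /tnthP[k jk]].
by apply: contraNneq ab_j => /rowP/(_ k); rewrite !mxE -jk => ->.
Qed.

Lemma hamming_gt0 (A : eqType) n (x y : 'rV[A]_n) :
  (0 < hamming x y)%N = (x != y).
Proof.
apply/idP/idP => [|xy].
  apply: contraTneq => ->; rewrite -eqn0Ngt cards_eq0.
  by apply/eqP/setP=> i; rewrite !inE eqxx.
rewrite card_gt0; apply: contraNneq xy => /setP xy0; apply/eqP/rowP=> i.
by have := xy0 i; rewrite !inE => /negbFE/eqP.
Qed.

Local Close Scope complex_scope.
Local Close Scope sesquilinear_scope.

Theorem corollary3 (R : rcfType) (n Delta : nat) (hn : (2 <= n)%N)
    (hDelta : (1 <= Delta)%N)
    (e : rel 'I_n) (e_sym : symmetric e) (e_irr : irreflexive e)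
    (hG : ramanujan R e Delta)
    (l : 'I_n -> Delta.-tuple 'I_n) (hl : neighbor_listing e l)
    (F : finFieldType) (L : fieldExtType F) (hL : \dim {:L} = Delta)
    (iota : {linear 'rV[F]_Delta -> L}) (hiota : bijective iota)
    (k D : nat) (r0 delta0 : R)
    (hk : k%:R = r0 * n%:R) (hD : D%:R = delta0 * n%:R)
    (C : {vspace 'rV[F]_n}) (hC : is_code k D C) :
  exists d : nat,
    is_min_distance (expander_code iota l C) d /\
    (Delta%:R * delta0 * n%:R) / (delta0 * Delta%:R + 4 * (1 - delta0))
      <= d%:R.
Proof.
have [_ [[x0 [y0 [Cx0 Cy0 xy0 def_D]]] C_dist]] := hC.
pose phi : 'rV[F]_n -> 'rV[L]_n := phi_exp iota l.
pose dist (p : 'rV[F]_n * 'rV[F]_n) := hamming (phi p.1) (phi p.2).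
pose distinct (p : 'rV[F]_n * 'rV[F]_n) :=
  [&& p.1 \in C, p.2 \in C & p.1 != p.2].
have D_gt0 : (0 < D)%N by rewrite -def_D hamming_gt0.
have D_le_n : (D <= n)%N by rewrite -def_D -[leqRHS](card_ord n) max_card.
have n_gt0 : 0 < n%:R :> R by rewrite ltr0n ltnW.
have hamE a b := hamming_phi_exp a b hl (bij_inj hiota).
have dist_bound p : distinct p ->
    (Delta * D * n)%:R <=
      (dist p)%:R * ((Delta * D)%:R + 4 * (n%:R - D%:R)) :> R.
  case: p => a b /and3P[/= Ca Cb ab]; rewrite /dist hamE.
  by apply: ramanujan_expansion; rewrite // D_gt0 C_dist.
(* Distance zero between the images would give Delta D n <= 0, although all three factors are
   positive. *)
have phi_neq a b : a \in C -> b \in C -> a != b -> phi a != phi b.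
  move=> Ca Cb ab; rewrite -hamming_gt0 lt0n; apply/eqP => d0.
  have := @dist_bound (a, b).
  rewrite /dist /distinct /= d0 Ca Cb ab mul0r => /(_ isT).
  by rewrite lern0 !muln_eq0 !eqn0Ngt hDelta D_gt0 (ltnW hn).
have dist0 : distinct (x0, y0) by apply/and3P.
(* The minimum is taken over the finitely many pairs of distinct words of C; a pair realising D
   shows that there is one. *)
have [p /and3P[Cp1 Cp2 p12] p_min] := arg_minnP dist dist0.
have codeP w :
    reflect (exists2 a, a \in C & w = phi a) (w \in expander_code iota l C).
  apply: (iffP existsP) => [[a /andP[Ca /eqP ->]]|[a Ca ->]]; exists a => //.
  by rewrite Ca eqxx.
exists (dist p); split; first split.
- exists (phi p.1), (phi p.2); split=> //; last exact: phi_neq.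
  + by apply/codeP; exists p.1.
  + by apply/codeP; exists p.2.
- move=> _ _ /codeP[a Ca ->] /codeP[b Cb ->] ab.
  apply: (p_min (a, b)); apply/and3P; split=> //.
  by apply: contraNneq ab => /= ->.
have den_gt0 : 0 < (Delta * D)%:R + 4 * (n%:R - D%:R) :> R.
  by rewrite ltr_pwDl ?mulr_ge0 ?subr_ge0 ?ler_nat // ltr0n muln_gt0 hDelta.
(* Since D = delta0 n, the stated denominator is that of [dist_bound] divided by n. *)
have denE : delta0 * Delta%:R + 4 * (1 - delta0) =
    ((Delta * D)%:R + 4 * (n%:R - D%:R)) / n%:R.
  by rewrite natrM hD; field; rewrite lt0r_neq0.
rewrite denE ler_pdivrMr ?divr_gt0 // mulrA ler_pdivlMr //.
rewrite -[Delta%:R * _ * _]mulrA -hD -!natrM.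
by apply: dist_bound; apply/and3P.
Qed.
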